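(* Let $(x_s)_{s\in S}$ be a normalized family in a Banach space $X$ (i.e. $\|x_s\|=1$ for all $s\in S$). Assume that for every chain $\beta\in\mathcal{C}(S)$, the sequence $(x_s)_{s\in\beta}$ is weakly null. Then there exists a subtree $T$ of $S$ with the following property: for every $\delta>0$ there exists a constant $C=C(\delta)>0$ such that for every chain $\beta=(s_n)_{n=1}^\infty$ of $T$, every absolutely convex combination $x=\sum_{n=1}^\infty a_nx_{s_n}$ with $\|x\|\ge\delta$ and every sequence $(\varepsilon_n)_{n\in\mathbb{N}}$ of signs, $$\Big\|\sum_{n=1}^\infty\varepsilon_na_nx_{s_n}\Big\|\ge C(\delta).$$ That is, for every chain $\beta\in\mathcal{C}(T)$, $(x_s)_{s\in\beta}$ is a convexly unconditional sequence and the constant $C=C(\delta)$ depends only on $\delta$.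
   Context: $S=\bigcup_{n=0}^\infty\{0,1\}^n$ is the dyadic tree of all finite sequences in $\{0,1\}$ (including the empty one), partially ordered by the initial segment relation $\le$. A subtree of $S$ is a subset $T\subseteq S$, with the induced order, which has a single minimal element and in which every element has exactly two immediate successors (i.e. for each $t\in T$ there are exactly two minimal elements of $\{t'\in T: t<t'\}$); thus $T$ is order isomorphic to $S$. A chain of a tree $T$ is an infinite linearly ordered subset of $T$; $\mathcal{C}(T)$ is the set of all chains of $T$. A chain is written $\beta=(s_n)_{n=1}^\infty$ with $s_1<s_2<\cdots$, and $(x_s)_{s\in\beta}$ denotes the sequence $(x_{s_n})_{n=1}^\infty$. An absolutely convex combination of a sequence $(y_n)$ is a sum $\sum_{n=1}^\infty a_ny_n$ with real $a_n$ and $\sum_{n=1}^\infty|a_n|=1$; signs are elements of $\{-1,1\}$. A normalized sequence $(y_n)$ in a Banach space is convexly unconditional if for every $\delta>0$ there is $C=C(\delta)>0$ such that for every absolutely convex combination $y=\sum_{n=1}^\infty a_ny_n$ with $\|y\|\ge\delta$ and every sequence $(\varepsilon_n)$ of signs, $\|\sum_{n=1}^\infty\varepsilon_na_ny_n\|\ge C(\delta)$. *)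

(* Defs.v *)
From HB Require Import structures.
From mathcomp Require Import all_boot all_order all_algebra.
From mathcomp Require Import all_classical all_reals all_analysis.

Set Implicit Arguments.
Unset Strict Implicit.
Unset Printing Implicit Defensive.

Import Order.TTheory GRing.Theory Num.Theory.
Import numFieldNormedType.Exports.

Local Open Scope classical_set_scope.
Local Open Scope ring_scope.

(* The dyadic tree S: finite 0/1 sequences, ordered by [prefix]. *)
Definition dyadic := seq bool.

Definition sprefix (s t : dyadic) : Prop := prefix s t /\ s <> t.

Definition minimal_elements (A : set dyadic) : set dyadic :=
  [set t | A t /\ forall u, A u -> ~ sprefix u t].

Definition immediate_successors (T : set dyadic) (t : dyadic) : set dyadic :=
  minimal_elements [set u | T u /\ sprefix t u].

Definition subtree (T : set dyadic) : Prop :=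
  (exists r, minimal_elements T = [set r]) /\
  (forall t, T t ->
     exists u v, u <> v /\ immediate_successors T t = [set u; v]).

Definition chain (T : set dyadic) (beta : set dyadic) : Prop :=
  [/\ beta `<=` T,
      infinite_set beta &
      forall s t, beta s -> beta t -> prefix s t \/ prefix t s].

(* s is the increasing enumeration of beta.  Every chain has exactly one such
   enumeration (list its elements by increasing length), so quantifying over s
   amounts to fixing it. *)
Definition chain_enum (beta : set dyadic) (s : nat -> dyadic) : Prop :=
  (forall n, sprefix (s n) (s n.+1)) /\ range s = beta.

Definition weakly_null (R : realType) (X : normedModType R) (y : nat -> X) :
    Prop :=
  forall f : {linear X -> R^o}, continuous f -> f (y n) @[n --> \oo] --> (0 : R^o).

(* sum_n |a_n| = 1; convergence of the series is part of the condition. *)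
Definition absolutely_convex (R : realType) (a : nat -> R) : Prop :=
  series (fun n => `|a n|) @ \oo --> (1 : R).

Definition signs (R : realType) (eps : nat -> R) : Prop :=
  forall n, eps n = 1 \/ eps n = -1.

(* The sum of sum_n a_n y_n.  [limn] is a default value on divergent sequences,
   but the series converges when X is complete, y is bounded and
   sum_n |a_n| converges, which is the only case where it is used. *)
Definition combination (R : realType) (X : completeNormedModType R)
    (a : nat -> R) (y : nat -> X) : X :=
  limn (series (fun n => a n *: y n)).

Definition unconditional_bound (R : realType) (X : completeNormedModType R)
    (y : nat -> X) (delta C : R) : Prop :=
  forall a : nat -> R, absolutely_convex a ->
  delta <= `|combination a y| ->
  forall eps : nat -> R, signs eps ->
  C <= `|combination (fun n => eps n * a n) y|.

Definition convexly_unconditional (R : realType)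
    (X : completeNormedModType R) (y : nat -> X) : Prop :=
  (forall n, `|y n| = 1) /\
  (forall delta : R, 0 < delta ->
     exists C : R, 0 < C /\ unconditional_bound y delta C).

(* Main.v *)
(** Call a chain element t removable for a set K of functionals of norm at most
    1 if, whenever some f in K satisfies f (x s) >= d at given later elements s
    of the chain, some g in K does so too with moreover |g (x t)| <= e.  An
    accept/reject argument (the open case of the chain Ramsey theorem for trees)
    yields a perfect set of nodes in which every element of every chain is
    removable: otherwise, along some infinite chain, a weak-star cluster point of
    functionals would stay bounded away from 0, against weak nullity.  Fusing
    over all constraints met so far gives a subtree in which, for each d and
    along each chain, the values f (x s) >= d on a finite set F can be kept by a
    functional g that is small on the rest of the chain, apart from finitely many
    initial terms.  Taking for F the part of a combination on which the signs are
    constant gives the lower bound.  If instead an initial coefficient is large,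
    one uses that the subtree is also chosen so that the functionals norming the
    vectors x u are almost biorthogonal along chains. *)

Require Import Defs.
From HB Require Import structures.
From mathcomp Require Import all_boot all_order all_algebra.
From mathcomp Require Import all_classical all_reals all_analysis.
From mathcomp Require Import ring lra.
Import Order.TTheory GRing.Theory Num.Theory.
Import numFieldNormedType.Exports.
Local Open Scope classical_set_scope.
Local Open Scope ring_scope.
Set Implicit Arguments.
Unset Strict Implicit.
Unset Printing Implicit Defensive.

(** * Perfect sets of nodes and fusion *)

Definition spre (u v : dyadic) : bool := prefix u v && (u != v).

Lemma sprefixE u v : sprefix u v <-> spre u v.
Proof.
by split=> [[p /eqP n]|/andP[p /eqP n]]; [rewrite /spre p n|split].
Qed.

Lemma spre_prefix u v : spre u v -> prefix u v.
Proof. by case/andP. Qed.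

Lemma prefix_sub_size (u v : dyadic) : prefix u v -> (size u <= size v)%N.
Proof. by move=> /prefixP[w ->]; rewrite size_cat leq_addr. Qed.

Lemma prefix_takeE (u v : dyadic) : prefix u v -> take (size u) v = u.
Proof. by rewrite prefixE => /eqP. Qed.

Lemma prefix_size_eq (u v : dyadic) :
  prefix u v -> (size v <= size u)%N -> u = v.
Proof. by move=> /prefix_takeE uv vu; rewrite -uv take_oversize. Qed.

Lemma prefix_anti (u v : dyadic) : prefix u v -> prefix v u -> u = v.
Proof. by move=> uv /prefix_sub_size; exact: prefix_size_eq. Qed.

Lemma spre_size u v : spre u v -> (size u < size v)%N.
Proof.
move=> /andP[uv]; apply: contraNT; rewrite -leqNgt => vu.
by apply/eqP; exact: prefix_size_eq.
Qed.

Lemma prefix_comparable (u v w : dyadic) :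
  prefix u w -> prefix v w -> prefix u v \/ prefix v u.
Proof.
move=> /prefix_takeE uw /prefix_takeE vw.
case: (leqP (size u) (size v)) => [uv|/ltnW vu]; [left|right].
  by rewrite prefixE -{1}vw take_takel // uw.
by rewrite prefixE -{1}uw take_takel // vw.
Qed.

Lemma spre_irr : irreflexive spre.
Proof. by move=> u; rewrite /spre eqxx andbF. Qed.

Lemma spre_prefix_trans u v w : spre u v -> prefix v w -> spre u w.
Proof.
move=> uv vw; rewrite /spre (prefix_trans (spre_prefix uv) vw) /=.
apply/eqP => uw; have := spre_size uv.
by rewrite uw ltnNge prefix_sub_size.
Qed.

Lemma spre_trans : transitive spre.
Proof. by move=> v u w uv /spre_prefix; exact: spre_prefix_trans. Qed.

Definition incomparable (u v : dyadic) : Prop := ~~ prefix u v /\ ~~ prefix v u.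

Lemma incomparable_sym u v : incomparable u v -> incomparable v u.
Proof. by case. Qed.

Lemma incomparable_prefix (u v u' v' : dyadic) : incomparable u v ->
  prefix u u' -> prefix v v' -> incomparable u' v'.
Proof.
move=> [uv vu] uu' vv'; split.
  apply/negP => u'v'.
  by have [] := prefix_comparable (prefix_trans uu' u'v') vv'; apply/negP.
apply/negP => v'u'.
by have [] := prefix_comparable uu' (prefix_trans vv' v'u'); apply/negP.
Qed.

Lemma dyadic_trichotomy (s t : dyadic) :
  [\/ prefix s t, prefix t s |
      exists r b, prefix (rcons r b) s /\ prefix (rcons r (~~ b)) t].
Proof.
elim: s t => [|b s IH] [|c t]; try by [constructor 1 | constructor 2].
have [<-|] := eqVneq b c.
  case: (IH t) => [st|ts|[r [d [rs rt]]]].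
  - by constructor 1; rewrite prefix_cons eqxx.
  - by constructor 2; rewrite prefix_cons eqxx.
  - by constructor 3; exists (b :: r), d; rewrite !rcons_cons !prefix_cons !eqxx.
move=> bc; constructor 3; exists [::], b; rewrite /= !prefix0s eqxx.
by split => //; case: b c bc => [] [].
Qed.

(* A perfect set plays the role of a subtree; unlike subtrees, perfect sets need
   no root, so the part of a perfect set lying above one of its nodes is again
   perfect. *)
Definition perfect (N : set dyadic) : Prop :=
  N !=set0 /\ forall u, N u -> exists v w,
    [/\ N v, N w, spre u v, spre u w & incomparable v w].

Definition above (N : set dyadic) (u : dyadic) : set dyadic :=
  [set v | N v /\ spre u v].

Lemma above_sub N u : above N u `<=` N.
Proof. by move=> v []. Qed.

Lemma aboveS {N M u} : N `<=` M -> above N u `<=` above M u.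
Proof. by move=> NM v [/NM]. Qed.

Lemma perfect_above N u : perfect N -> N u -> perfect (above N u).
Proof.
move=> [_ pN] Nu; split.
  by have [v [_ [Nv _ uv _ _]]] := pN u Nu; exists v.
move=> v [Nv uv]; have [a [b [Na Nb va vb ab]]] := pN v Nv.
exists a, b; split => //; split => //.
- exact: spre_trans va.
- exact: spre_trans vb.
Qed.

Lemma perfect_above2 N u : perfect N -> N u -> exists M0 M1,
  [/\ perfect M0, perfect M1, M0 `<=` above N u, M1 `<=` above N u &
      forall a b, M0 a -> M1 b -> incomparable a b].
Proof.
move=> pN Nu; have [v [w [Nv Nw uv uw vw]]] := pN.2 u Nu.
exists (above N v), (above N w); split; [exact: perfect_above..| | |].
- by move=> a [Na va]; split=> //; exact: spre_trans va.
- by move=> a [Na wa]; split=> //; exact: spre_trans wa.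
- by move=> a b [_ /spre_prefix va] [_ /spre_prefix wb]; exact: incomparable_prefix vw va wb.
Qed.

(** Either [c] is dense in [N] above some node [u], and then the part of [c] in [N] above [u] still
    branches everywhere, or some node [v] of [N] has no member of [c] in [N] above it, and the cone
    above [v] avoids [c]. *)
Lemma perfect_color N (c : set dyadic) : perfect N ->
  exists2 M, perfect M /\ M `<=` N & M `<=` c \/ M `<=` ~` c.
Proof.
move=> pN.
have [[u Nu dense]|nd] := pselect (exists2 u, N u &
    forall v, N v -> spre u v -> exists2 w, (N `&` c) w & spre v w).
  exists (above (N `&` c) u).
    split; last by move=> v [[]].
    split.
      have [v [_ [Nv _ uv _ _]]] := pN.2 u Nu.
      by have [w Nw vw] := dense v Nv uv; exists w; split=> //; exact: spre_trans vw.
    move=> v [[Nv cv] uv]; have [a [b [Na Nb va vb ab]]] := pN.2 v Nv.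
    have [a' ca aa'] := dense a Na (spre_trans uv va).
    have [b' cb bb'] := dense b Nb (spre_trans uv vb).
    exists a', b'; split.
    - by split=> //; exact: spre_trans (spre_trans uv va) aa'.
    - by split=> //; exact: spre_trans (spre_trans uv vb) bb'.
    - exact: spre_trans aa'.
    - exact: spre_trans bb'.
    - exact: incomparable_prefix ab (spre_prefix aa') (spre_prefix bb').
  by left=> v [[]].
have [u Nu] := pN.1.
have [v Nv nv] : exists2 v, N v & forall w, (N `&` c) w -> ~ spre v w.
  apply: contrapT => nex; apply: nd; exists u => // v Nv _.
  apply: contrapT => nw; apply: nex; exists v => // w cw vw.
  by apply: nw; exists w.
exists (above N v); first by split; [exact: perfect_above|exact: above_sub].
by right=> w [Nw vw] cw; apply: (nv w).
Qed.

Definition increasing_chain (b : nat -> dyadic) : Prop :=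
  forall n, spre (b n) (b n.+1).

Lemma perfect_chain N : perfect N ->
  exists2 b, increasing_chain b & forall n, N (b n).
Proof.
move=> [[u Nu] pN].
pose P (a b : dyadic) := N a -> N b /\ spre a b.
have [f fP] : {f & forall a, P a (f a)}.
  apply: choice => a; have [Na|nNa] := pselect (N a); last by exists a.
  by have [v [_ [Nv _ av _ _]]] := pN a Na; exists v.
have NP n : N (iter n f u) by elim: n => [|n /fP[]].
by exists (fun n => iter n f u) => // n; have [] := fP _ (NP n).
Qed.

Lemma increasing_chain_ltn b : increasing_chain b ->
  forall m n, (m < n)%N -> spre (b m) (b n).
Proof.
move=> ib m n; elim: n => // n IH; rewrite ltnS leq_eqVlt => /predU1P[->//|/IH mn].
exact: spre_trans (ib n).
Qed.

Lemma increasing_chain_inj b : increasing_chain b -> injective b.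
Proof.
move=> ib m n mn; case: (ltngtP m n) => // /(increasing_chain_ltn ib);
  by rewrite mn spre_irr.
Qed.

Lemma increasing_chain_size b : increasing_chain b -> forall n, (n <= size (b n))%N.
Proof.
by move=> ib; elim=> // n IH; apply: leq_ltn_trans IH (spre_size (ib n)).
Qed.

(** Only one-step conditions are required, since these can be read off a recursive construction;
    that [t] preserves and reflects the prefix order follows from them. *)
Definition tree_embedding (t : dyadic -> dyadic) : Prop :=
  (forall s b, spre (t s) (t (rcons s b))) /\
  (forall s, incomparable (t (rcons s false)) (t (rcons s true))).

Section TreeEmbedding.
Variables (t : dyadic -> dyadic) (tP : tree_embedding t).

Lemma tree_embedding_prefix r s : prefix r s -> prefix (t r) (t s).
Proof.
move=> /prefixP[w ->{s}]; elim/last_ind: w => [|w b IH].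
  by rewrite cats0 prefix_refl.
by rewrite -rcons_cat; apply: prefix_trans IH (spre_prefix (tP.1 _ _)).
Qed.

Lemma tree_embedding_incomparable r b s s' :
  prefix (rcons r b) s -> prefix (rcons r (~~ b)) s' -> incomparable (t s) (t s').
Proof.
move=> /tree_embedding_prefix rs /tree_embedding_prefix rs'.
apply: incomparable_prefix rs rs'.
by case: b; [apply: incomparable_sym|]; apply: tP.2.
Qed.

Lemma tree_embedding_prefixE r s : prefix (t r) (t s) = prefix r s.
Proof.
apply/idP/idP; last exact: tree_embedding_prefix.
case: (dyadic_trichotomy r s) => // [sr rs|[q [b [qr qs]]]].
  have trs := prefix_anti rs (tree_embedding_prefix sr).
  move: sr trs {rs} => /prefixP[[|b w] ->]; first by rewrite cats0 prefix_refl.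
  rewrite -cat_rcons => /esym tsr.
  have := spre_prefix_trans (tP.1 s b)
            (tree_embedding_prefix (prefix_prefix (rcons s b) w)).
  by rewrite tsr spre_irr.
by have [/negPf->] := tree_embedding_incomparable qr qs.
Qed.

Lemma tree_embedding_inj : injective t.
Proof.
by move=> r s rs; apply: prefix_anti; rewrite -tree_embedding_prefixE rs prefix_refl.
Qed.

Lemma tree_embedding_spre r s : spre (t r) (t s) = spre r s.
Proof. by rewrite /spre tree_embedding_prefixE (inj_eq tree_embedding_inj). Qed.

Lemma perfect_range_embedding : perfect (range t).
Proof.
split; first by exists (t [::]), [::].
move=> _ [s _ <-]; exists (t (rcons s false)), (t (rcons s true)).
by split; [exists (rcons s false)|exists (rcons s true)|exact: tP.1..|exact: tP.2].
Qed.

Lemma spre_rcons s w : spre s w -> exists b, prefix (rcons s b) w.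
Proof.
move=> /andP[/prefixP[[|b v] ->]]; first by rewrite cats0 eqxx.
by move=> _; exists b; rewrite -cat_rcons prefix_prefix.
Qed.

Lemma subtree_range_embedding : subtree (range t).
Proof.
split.
  exists (t [::]); apply/seteqP; split=> [_ [[s _ <-] min]|_ ->].
    apply: contrapT => nst; apply: (min (t [::])); first by exists [::].
    by split; [rewrite tree_embedding_prefixE prefix0s|apply: nesym].
  split; first by exists [::].
  move=> _ [s _ <-] /sprefixE; rewrite tree_embedding_spre.
  by move=> /spre_size.
move=> _ [s _ <-]; exists (t (rcons s false)), (t (rcons s true)); split.
  by move=> /tree_embedding_inj/eqP; rewrite eqseq_rcons andbF.
have rc b : spre s (rcons s b) by rewrite -tree_embedding_spre tP.1.
apply/seteqP; split.
  move=> _ [[[w _ <-] /sprefixE]]; rewrite tree_embedding_spre => sw min.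
  have [b bw] := spre_rcons sw.
  have [<-|nbw] := eqVneq (rcons s b) w; first by case: (b); [right|left].
  exfalso; apply: (min (t (rcons s b))).
    by split; [exists (rcons s b)|apply/sprefixE; rewrite tree_embedding_spre].
  by apply/sprefixE; rewrite tree_embedding_spre /spre bw nbw.
have suc b : immediate_successors (range t) (t s) (t (rcons s b)).
  split.
    by split; [exists (rcons s b)|apply/sprefixE; rewrite tree_embedding_spre].
  move=> _ [[w _ <-] /sprefixE]; rewrite tree_embedding_spre => sw /sprefixE.
  rewrite tree_embedding_spre => /spre_size; rewrite size_rcons ltnS.
  by rewrite leqNgt (spre_size sw).
by move=> _ [->|->]; exact: suc.
Qed.

End TreeEmbedding.

(** Each [s] receives a perfect set [st s]. A node [t s] is picked in it, the cone above that node
    is shrunk until [D] holds, and two mutually incomparable perfect pieces of the result serve the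
    two successors of [s]. Everything chosen later above [t s] lies in these pieces, so heredity of
    [D] gives the conclusion. *)
Lemma fusion (D : dyadic -> set dyadic -> Prop) (N : set dyadic) :
  (forall u M M', M' `<=` M -> D u M -> D u M') ->
  (forall u M, perfect M -> exists2 M', perfect M' /\ M' `<=` M & D u M') ->
  perfect N ->
  exists2 t, tree_embedding t &
    range t `<=` N /\ forall u, range t u -> D u (above (range t) u).
Proof.
move=> Dher Ddense pN.
pose PT := {M : set dyadic | perfect M}.
pose step (M : PT) (p : dyadic * (PT * PT)) :=
  [/\ sval M p.1, sval p.2.1 `<=` above (sval M) p.1,
      sval p.2.2 `<=` above (sval M) p.1,
      (forall a b, sval p.2.1 a -> sval p.2.2 b -> incomparable a b) &
      D p.1 (sval p.2.1 `|` sval p.2.2)].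
have [f fP] : {f & forall M, step M (f M)}.
  apply: choice => -[M pM]; have [u Mu] := pM.1.
  have [M' [pM' M'M] DM'] := Ddense u _ (perfect_above pM Mu).
  have [v M'v] := pM'.1.
  have [M0 [M1 [p0 p1 M0v M1v inc]]] := perfect_above2 pM' M'v.
  have M0' := subset_trans M0v (@above_sub _ _).
  have M1' := subset_trans M1v (@above_sub _ _).
  exists (u, (exist _ M0 p0, exist _ M1 p1)); split=> //=.
  - exact: subset_trans M'M.
  - exact: subset_trans M'M.
  - by apply: Dher DM' => a [/M0'|/M1'].
pose next (M : PT) (b : bool) := if b then (f M).2.2 else (f M).2.1.
pose st (s : dyadic) := foldl next (exist _ N pN) s.
pose t s := (f (st s)).1.
have stS s b : st (rcons s b) = next (st s) b by rewrite /st foldl_rcons.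
have nextsub M b : sval (next M b) `<=` above (sval M) (f M).1.
  by case: (fP M) => _ ? ? _ _; case: b.
have stsub s w : sval (st (s ++ w)) `<=` sval (st s).
  elim/last_ind: w => [|w b IH]; first by rewrite cats0.
  rewrite -rcons_cat stS; apply: subset_trans IH.
  by apply: subset_trans (nextsub _ _) _; exact: above_sub.
have tst s : sval (st s) (t s) by case: (fP (st s)).
have tP : tree_embedding t.
  split=> [s b|s].
    by have /nextsub[] : sval (next (st s) b) (t (rcons s b)) by rewrite -stS.
  have [_ _ _ + _] := fP (st s); apply.
    by have := tst (rcons s false); rewrite stS.
  by have := tst (rcons s true); rewrite stS.
exists t => //; split.
  by move=> _ [s _ <-]; have := @stsub [::] s _ (tst s).
(* A node of the range strictly above [t s] has an index extending [rcons s b] for some [b], hence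
   lies in one of the two pieces on which [D] was secured. *)
move=> _ [s _ <-]; have [_ _ _ _] := fP (st s); apply: Dher.
move=> _ [[w _ <-]]; rewrite tree_embedding_spre // => /spre_rcons[b /prefixP[v ->]].
have := stsub _ _ _ (tst (rcons s b ++ v)).
by rewrite stS /next; case: b => ?; [right|left].
Qed.

Lemma dense_finite (I : eqType) (r : seq I) (D : I -> set dyadic -> Prop) :
  (forall i M M', M' `<=` M -> D i M -> D i M') ->
  (forall i M, perfect M -> exists2 M', perfect M' /\ M' `<=` M & D i M') ->
  forall M, perfect M ->
    exists2 M', perfect M' /\ M' `<=` M & forall i, i \in r -> D i M'.
Proof.
move=> Dher Ddense M pM; elim: r => [|i r [M1 [pM1 M1M] DM1]].
  by exists M => //; split.
have [M2 [pM2 M2M1] DM2] := Ddense i M1 pM1.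
exists M2; first by split=> //; exact: subset_trans M1M.
by move=> j /predU1P[->//|/DM1]; exact: Dher.
Qed.

(** * A chain Ramsey dichotomy *)

(** [F] stands for the open set of chains with an initial segment in [F]. Accepting means that [s]
    followed by any chain of [N] enters this set at or after the end of [s]. *)
Definition accepts (F : set (seq dyadic)) (s : seq dyadic) (N : set dyadic) :=
  forall b, increasing_chain b -> (forall n, N (b n)) ->
    exists n, F (s ++ mkseq b n).

Definition rejects (F : set (seq dyadic)) (s : seq dyadic) (N : set dyadic) :=
  forall M, perfect M -> M `<=` N -> ~ accepts F s M.

Section Galvin.
Variable F : set (seq dyadic).

Lemma acceptsS s M N : M `<=` N -> accepts F s N -> accepts F s M.
Proof. by move=> MN aN b ib bM; apply: aN => // n; exact: MN. Qed.

Lemma rejectsS s M N : M `<=` N -> rejects F s N -> rejects F s M.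
Proof. by move=> MN rN M' pM' M'M; apply: rN => //; exact: subset_trans MN. Qed.

Lemma decide_accepts s N : perfect N ->
  exists2 M, perfect M /\ M `<=` N & accepts F s M \/ rejects F s M.
Proof.
move=> pN.
have [[M pM MN]|nM] :=
  pselect (exists2 M, perfect M /\ M `<=` N & accepts F s M).
  by exists M => //; left.
exists N; first by split.
by right=> M pM MN aM; apply: nM; exists M.
Qed.

(** A fusion decides every one-point extension of [s] above its new point, and a colouring makes the
    decision uniform. Uniform acceptance would make a perfect subset of [N] accept [s]. *)
Lemma rejects_rcons s N : perfect N -> rejects F s N ->
  exists2 M, perfect M /\ M `<=` N & forall u, M u -> rejects F (rcons s u) (above M u).
Proof.
move=> pN rN.
have [||//|t tP [tN tD]] := @fusion (fun u M =>
    accepts F (rcons s u) M \/ rejects F (rcons s u) M) N.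
- by move=> u M M' M'M [/(acceptsS M'M)|/(rejectsS M'M)]; [left|right].
- by move=> u M; exact: decide_accepts.
have pT := perfect_range_embedding tP.
have [M [pM MT] [Mc|Mc]] :=
    perfect_color [set u | accepts F (rcons s u) (above (range t) u)] pT; last first.
  exists M; first by split=> //; exact: subset_trans tN.
  move=> u Mu; apply: rejectsS (aboveS MT) _.
  by case: (tD u (MT u Mu)) => // /(Mc u Mu).
(* The first term of a chain in [M] is an accepted extension, and the tail of the chain runs above
   it. *)
exfalso; apply: (rN M pM (subset_trans MT tN)) => b ib bM.
have [|n|n Fn] := Mc (b 0) (bM 0) (fun n => b n.+1).
- by move=> n; exact: ib.
- by split; [exact/MT/bM|exact: increasing_chain_ltn].
exists n.+1; move: Fn; rewrite cat_rcons /mkseq /=.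
by rewrite -[1%N]/(1 + 0)%N iotaDl -map_comp.
Qed.

(* The chains below a node [u] are thus indexed by a finite type. *)
Definition subset_prefixes (u : dyadic) (A : {set 'I_(size u).+1}) : seq dyadic :=
  [seq take (val i) u | i <- enum A].

(** A prefix of [u] is determined by its length, so an increasing sequence of prefixes is determined
    by the set of lengths occurring in it. *)
Lemma chain_subset_prefixes (u : dyadic) (s : seq dyadic) :
  sorted spre s -> {in s, forall v, prefix v u} ->
  exists A : {set 'I_(size u).+1}, s = subset_prefixes A.
Proof.
move=> ss su; exists [set i | take (val i) u \in s]%SET.
apply: (irr_sorted_eq spre_trans spre_irr ss).
  rewrite /subset_prefixes sorted_map.
  have si : sorted (fun i j : 'I_(size u).+1 => (i < j)%N)
      (enum [set i | take (val i) u \in s]%SET).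
    rewrite {1}/enum_mem; apply: sorted_filter; first by move=> ? ? ?; exact: ltn_trans.
    by rewrite -(@sorted_map _ _ val ltn) -enumT val_enum_ord iota_ltn_sorted.
  apply: sub_sorted si => i j /= ij.
  have iu : (i <= size u)%N by rewrite -ltnS.
  have ju : (j <= size u)%N by rewrite -ltnS.
  rewrite /spre prefixE size_takel // take_takel ?(ltnW ij) // eqxx /=.
  apply/eqP => /(congr1 size); rewrite !size_takel // => ij'.
  by rewrite ij' ltnn in ij.
move=> v; apply/idP/mapP => [vs|[i + ->]]; last by rewrite mem_enum inE.
have vu := su v vs.
have lt : (size v < (size u).+1)%N by rewrite ltnS prefix_sub_size.
by exists (Ordinal lt); rewrite ?mem_enum ?inE /= prefix_takeE.
Qed.

(** If no perfect subset accepts the empty sequence, a fusion handles at each node [u] the finitely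
    many sequences of prefixes of [u], so that rejection passes from a sequence to its one-point
    extensions. By induction all increasing sequences of the tree are rejected, while a member of
    [F] is accepted at once. *)
Lemma galvin N : perfect N ->
  exists2 M, perfect M /\ M `<=` N &
    accepts F [::] M \/
    forall s, sorted spre s -> (forall u, u \in s -> M u) -> ~ F s.
Proof.
move=> pN.
have [M [pM MN] [aM|rM]] := decide_accepts [::] pN; first by exists M => //; left.
have [M1 [pM1 M1M] M1r] := rejects_rcons pM rM.
pose D s M := accepts F s M \/ forall v, M v -> rejects F (rcons s v) (above M v).
have Dher s M2 M3 : M3 `<=` M2 -> D s M2 -> D s M3.
  move=> M32 [/(acceptsS M32)|H]; first by left.
  by right=> v M3v; exact: rejectsS (aboveS M32) (H v (M32 v M3v)).
have Ddense s M2 : perfect M2 -> exists2 M3, perfect M3 /\ M3 `<=` M2 & D s M3.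
  move=> pM2; have [M3 [pM3 M32] [aM3|rM3]] := decide_accepts s pM2.
    by exists M3 => //; left.
  have [M4 [pM4 M43] H] := rejects_rcons pM3 rM3.
  by exists M4; [split=> //; exact: subset_trans M32|right].
have [||//|t tP [tM1 tD]] := @fusion (fun u M =>
    forall A : {set 'I_(size u).+1}, D (subset_prefixes A) M) M1.
- by move=> u M2 M3 M32 DM2 A; exact: Dher (DM2 A).
- move=> u M2 pM2.
  have [M3 pM3 DM3] := @dense_finite {set 'I_(size u).+1}
    (enum {: {set 'I_(size u).+1}}) (fun A => D (subset_prefixes A))
    (fun A => @Dher _) (fun A => @Ddense _) M2 pM2.
  by exists M3 => // A; apply: DM3; rewrite mem_enum.
have pT := perfect_range_embedding tP.
exists (range t).
  by split=> //; apply: subset_trans tM1 _; exact: subset_trans MN.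
right=> s ss sT Fs.
(* Induction on [r]: one-point sequences are rejected by the choice of [M1]; for longer ones the
   fusion property is used at [w], the last point before [v]. *)
have rs v r : sorted spre (rcons r v) -> (forall u, u \in rcons r v -> range t u) ->
    rejects F (rcons r v) (above (range t) v).
  elim/last_ind: r v => [|r w IH] v srv rT.
    by apply: rejectsS (aboveS tM1) (M1r v (tM1 v _)); apply: rT; rewrite inE.
  have wv : spre w v.
    by move: srv; rewrite -cats1 cat_rcons sorted_cat_cons => /andP[_ /= /andP[]].
  have srw : sorted spre (rcons r w).
    by move: srv; rewrite -cats1 => /cat_sorted2[].
  have rwT u : u \in rcons r w -> range t u.
    by move=> ur; apply: rT; rewrite mem_rcons inE ur orbT.
  have wT : range t w by apply: rwT; rewrite mem_rcons inE eqxx.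
  have vT : range t v by apply: rT; rewrite mem_rcons inE eqxx.
  have rej := IH w srw rwT.
  have [A Aeq] : exists A : {set 'I_(size w).+1}, rcons r w = subset_prefixes A.
    apply: chain_subset_prefixes => // u; rewrite mem_rcons inE => /predU1P[->|ur].
      exact: prefix_refl.
    move: srw; rewrite -cats1 (sorted_pairwise spre_trans) pairwise_cat.
    by move=> /andP[/allrelP/(_ u w ur) + _]; rewrite inE eqxx => /(_ isT)/spre_prefix.
  have [acc|/(_ v)] := tD w wT A.
    by exfalso; apply: (rej _ (perfect_above pT wT)) => //; rewrite Aeq.
  rewrite -Aeq => /(_ (conj vT wv)).
  by apply: rejectsS => z [zT vz]; split=> //; split=> //; exact: spre_trans vz.
have pF r P : perfect P -> F r -> ~ rejects F r P.
  by move=> pP Fr /(_ P pP); apply=> // b _ _; exists 0; rewrite cats0.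
case/lastP: s ss sT Fs => [|r v] ss sT Fs.
  exact: pF Fs rM.
apply: pF Fs (rs _ _ ss sT).
by apply: (perfect_above pT); apply: sT; rewrite mem_rcons inE eqxx.
Qed.

End Galvin.

(** * Norming functionals and cluster points *)

Definition dual_ball (R : realType) (X : normedModType R) (f : X -> R) : Prop :=
  (forall a y z, f (a *: y + z) = a * f y + f z) /\ forall y, `|f y| <= `|y|.

Section DualBall.
Variables (R : realType) (X : normedModType R).

Lemma dual_ball0 (f : X -> R) : dual_ball f -> f 0 = 0.
Proof. by move=> [fl _]; have := fl (-1) 0 0; rewrite scaler0 addr0; lra. Qed.

Lemma dual_ballN (f : X -> R) : dual_ball f -> dual_ball (fun y => - f y).
Proof. by move=> [fl fb]; split=> [a y z|y]; [rewrite fl; ring|rewrite normrN]. Qed.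

Lemma dual_ball_sum (f : X -> R) (I : Type) (r : seq I) (P : pred I) (a : I -> R)
  (y : I -> X) : dual_ball f ->
  f (\sum_(i <- r | P i) a i *: y i) = \sum_(i <- r | P i) a i * f (y i).
Proof.
move=> fB; elim/big_rec2: _ => [|i _ v _ <-]; first exact: dual_ball0.
exact: fB.1.
Qed.

(* The bound forces a subspace [g] of [X * R] to be single-valued, that is, the
   graph of a functional on a subspace of [X]. *)
Definition bounded_graph (g : set (X * R)) : Prop :=
  (forall a p q, g p -> g q -> g (a *: p.1 + q.1, a * p.2 + q.2)) /\
  (forall p, g p -> p.2 <= `|p.1|).

Lemma bounded_graph_extend (g : set (X * R)) z : bounded_graph g -> g !=set0 ->
  exists2 h, bounded_graph h & g `<=` h /\ exists c, h (z, c).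
Proof.
move=> [gl gb] [p0 gp0].
have g0 : g (0, 0).
  by have := gl (-1) _ _ gp0 gp0; rewrite scaleN1r mulN1r !addNr.
have gZ a p : g p -> g (a *: p.1, a * p.2).
  by move=> gp; have := gl a _ _ gp g0; rewrite !addr0.
(* The value [c] at [z] need only respect the bound for the coefficients 1 and -1 of [z]; scaling
   covers all others. Such a [c] exists because the triangle inequality puts every left side below
   every right side. *)
have [c cP] : exists c, forall p, g p -> p.2 - `|p.1 - z| <= c <= `|p.1 + z| - p.2.
  pose E := [set p.2 - `|p.1 - z| | p in g].
  have ub q : g q -> ubound E (`|q.1 + z| - q.2).
    move=> gq _ [p gp <-]; have := gb _ (gl 1 _ _ gp gq); rewrite /= scale1r mul1r.
    have := ler_normD (p.1 - z) (q.1 + z); rewrite addrACA addNr addr0; lra.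
  exists (sup E) => p gp; apply/andP; split.
    apply: ub_le_sup; last by exists p.
    by exists (`|0 + z| - 0); exact: (ub (0, 0)).
  by apply: ge_sup; [exists (p.2 - `|p.1 - z|), p|exact: ub].
exists [set q | exists2 p, g p & exists t, q = (p.1 + t *: z, p.2 + t * c)]; last first.
  split=> [p gp|]; first by exists p => //; exists 0; rewrite scale0r mul0r !addr0; case: p gp.
  by exists c, (0, 0) => //; exists 1; rewrite scale1r mul1r !add0r.
split.
  move=> a _ _ [p gp [t ->]] [q gq [s ->]]; exists (a *: p.1 + q.1, a * p.2 + q.2).
    exact: gl.
  exists (a * t + s) => /=; congr (_, _); last by ring.
  by rewrite scalerDr scalerDl scalerA addrACA.
move=> _ [p gp [t ->]] /=.
have [->|t0] := eqVneq t 0; first by rewrite scale0r mul0r !addr0; exact: gb.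
have [tp|tn] := ltP 0 t.
  have /andP[_] := cP _ (gZ t^-1 p gp).
  rewrite /= -{1}(scalerK t0 z) -scalerDr normrZ gtr0_norm ?invr_gt0 // -mulrBr.
  by rewrite mulrC ler_pdivlMr // lerBrDl mulrC.
have tp : 0 < - t by rewrite oppr_gt0 lt_neqAle t0.
have /andP[+ _] := cP _ (gZ (- t)^-1 p gp).
have tN : - t != 0 by rewrite oppr_eq0.
rewrite /= -{1}(scalerK tN z) -scalerBr normrZ gtr0_norm ?invr_gt0 // -mulrBr.
rewrite mulrC ler_pdivrMr // scaleNr opprK; lra.
Qed.

Lemma hahn_banach_norming (y0 : X) : exists2 f, dual_ball f & f y0 = `|y0|.
Proof.
have [] := @Zorn_bigcup _ [set g : set (X * R) |
    bounded_graph g /\ (g !=set0 -> g (y0, `|y0|))].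
  move=> F FP tot; split; last first.
    by move=> [p [g Fg gp]]; exists g => //; apply: (FP g Fg).2; exists p.
  split=> [a p q [g Fg gp] [h Fh hq]|p [g Fg gp]]; last exact: (FP g Fg).1.2.
  have [gh|hg] := tot g h Fg Fh.
    by exists h => //; apply: (FP h Fh).1.1 => //; exact: gh.
  by exists g => //; apply: (FP g Fg).1.1 => //; exact: hg.
move=> g [[gP gy0] gmax].
have gmax' h : bounded_graph h -> g `<=` h -> h (y0, `|y0|) -> h `<=` g.
  by move=> hP gh hy0; apply: contrapT => hg; apply: (gmax h).
have g0 : g !=set0.
  apply/set0P/negP => /eqP g0.
  have : g (y0, `|y0|); last by rewrite g0.
  (* The graph over the line through [y0] shows that the empty graph is not maximal. *)
  apply: (gmax' [set p | exists a, p = (a *: y0, a * `|y0|)]).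
  - split=> [a _ _ [s ->] [t ->]|_ [s ->]] /=.
      by exists (a * s + t); rewrite scalerDl scalerA mulrDl mulrA.
    by rewrite normrZ ler_wpM2r // ler_norm.
  - by rewrite g0.
  - by exists 1; rewrite scale1r mul1r.
  - by exists 1; rewrite scale1r mul1r.
have dom z : exists c, g (z, c).
  have [h hP [gh [c hc]]] := bounded_graph_extend z gP g0.
  by exists c; apply: (gmax' h hP gh _ _ hc); exact: gh (gy0 g0).
have [f fg] := choice dom.
have fun_g z r s : g (z, r) -> g (z, s) -> r = s.
  move=> gr gs; have := gP.2 _ (gP.1 (-1) _ _ gr gs).
  have := gP.2 _ (gP.1 (-1) _ _ gs gr).
  by rewrite /= scaleN1r addNr normr0; lra.
have fl a y z : f (a *: y + z) = a * f y + f z.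
  by apply: fun_g (fg _) _; exact: gP.1 (fg y) (fg z).
exists f; last exact: fun_g (fg _) (gy0 g0).
split=> // y; rewrite ler_norml (gP.2 _ (fg y)) andbT.
have := gP.2 _ (fg (-1 *: y + 0)) => /=.
have f0 : f 0 = 0 by have := fl (-1) 0 0; rewrite scaler0 addr0; lra.
by rewrite fl f0 addr0 scaleN1r addr0 normrN; lra.
Qed.

(** The limit is taken pointwise along an ultrafilter refining the filter at infinity; it exists
    because the values at [y] stay in a compact interval. Closed conditions that hold eventually
    pass to it. *)
Lemma dual_ball_cluster (h : nat -> X -> R) : (forall n, dual_ball (h n)) ->
  exists2 f, dual_ball f &
    forall y c N, (forall n, (N <= n)%N -> c <= `|h n y|) -> c <= `|f y|.
Proof.
move=> hB; have [U [UU sU]] := ultraFilterLemma eventually_filter.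
have lim y : exists l : R, h n y @[n --> U] --> l.
  have [|l [_ lcl]] := @segment_compact R (- `|y|) `|y| (h n y @[n --> U]) _.
    apply: (@filterS _ U _ setT); last exact: filterT.
    by move=> n _ /=; rewrite in_itv /= -ler_norml; exact: (hB n).2.
  exists l => V lV.
  have [//|UVC] := in_ultra_setVsetC ((fun n => h n y) @^-1` V) UU.
  by have [r []] := lcl (~` V) V UVC lV.
have [f fl] := choice lim.
exists f.
  split=> [a y z|y].
    apply: (@cvg_unique _ (@norm_hausdorff _ R) _ _ _ _ (fl _)).
    have -> : (fun n => h n (a *: y + z)) = (fun n => a * h n y + h n z).
      by apply/funext => n; exact: (hB n).1.
    by apply: cvgD (fl z); apply: cvgMr (fl y).
  apply: (@closed_cvg _ _ U _ (fun n => `|h n y|) (fun r => r <= `|y|)).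
  - exact: closed_le.
  - by apply: (@filterS _ U _ setT); [move=> n _; exact: (hB n).2|exact: filterT].
  - exact: cvg_norm (fl y).
move=> y c N hN.
apply: (@closed_cvg _ _ U _ (fun n => `|h n y|) (fun r => c <= r)).
- exact: closed_ge.
- by apply: sU; exists N.
- exact: cvg_norm (fl y).
Qed.

Lemma weakly_null_dual_ball (y : nat -> X) (f : X -> R) : weakly_null y ->
  dual_ball f -> f (y n) @[n --> \oo] --> (0 : R).
Proof.
move=> yn [fl fb].
pose m := GRing.isLinear.Build R X R^o _ (f : X -> R^o) fl.
pose F : {linear X -> R^o} := HB.pack (f : X -> R^o) m.
apply: (yn F); apply: bounded_linear_continuous.
apply/linear_boundedP; near=> r => z; apply: le_trans (fb z) _.
by rewrite ler_peMl //; near: r; apply: nbhs_pinfty_ge; exact: num_real.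
Unshelve. all: by end_near. Qed.

End DualBall.

(** * Removing points along chains *)

Section Removal.
Variables (R : realType) (X : normedModType R) (x : dyadic -> X).
Hypothesis x_null : forall b, increasing_chain b -> forall f : X -> R, dual_ball f ->
  forall e : R, 0 < e -> exists n, `|f (x (b n))| < e.

(** A perfect set on which [f] stays large would contain a chain contradicting weak nullity. *)
Lemma dual_ball_small N (f : X -> R) (e : R) : perfect N -> dual_ball f -> 0 < e ->
  exists2 M, perfect M /\ M `<=` N & forall t, M t -> `|f (x t)| <= e.
Proof.
move=> pN fB e0.
have [M pM [Mc|Mc]] := perfect_color [set t | `|f (x t)| <= e] pN.
  by exists M.
have [b ib bM] := perfect_chain pM.1.
have [n /ltW fn] := x_null ib fB e0.
by exfalso; exact: Mc (bM n) fn.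
Qed.

Definition removable (K : set (X -> R)) (d e : R) (t : dyadic) (s : seq dyadic) :=
  (exists2 f, K f & forall v, v \in s -> d <= f (x v)) ->
  exists2 g, K g & (forall v, v \in s -> d <= g (x v)) /\ `|g (x t)| <= e.

Definition removable_on (K : set (X -> R)) (d e : R) (M : set dyadic) :=
  forall t s, sorted spre (t :: s) -> (forall u, u \in t :: s -> M u) ->
  removable K d e t s.

(** The dichotomy is applied to the sequences [t :: s] with [t] not removable. If they were
    unavoidable, a chain [b] would carry for each [p] a functional in [K] of modulus at least [e] at
    the first [p.+1] points, and a cluster point would contradict weak nullity. *)
Lemma removable_dense (K : set (X -> R)) (d e : R) N : (forall f, K f -> dual_ball f) ->
  0 < e -> perfect N ->
  exists2 M, perfect M /\ M `<=` N & removable_on K d e M.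
Proof.
move=> KB e0 pN.
pose F : set (seq dyadic) :=
  [set r | if r is t :: s then ~ removable K d e t s else False].
have [M pM [acc|nF]] := galvin F pN; last first.
  exists M => // t s ts tsM; apply: contrapT => nr.
  exact: (nF (t :: s) ts tsM).
exfalso; have [b ib bM] := perfect_chain pM.1.
have hP p : exists h, K h /\ forall j, (j <= p)%N -> e <= `|h (x (b j))|.
  (* The chain formed by [b j] and all [b n] with [n > p] has an initial segment in [F], nonempty
     since [F] excludes the empty sequence. For [j > p] the value 0 is a dummy. *)
  have mP j : {m : nat | (j <= p)%N ->
      ~ removable K d e (b j) [seq b (p.+1 + i) | i <- iota 0 m]%N}.
    apply: cid; have [jp|//] := leqP j p; last by exists 0.
    have [||[//|m] Fm] := acc (fun n => if n is n'.+1 then b (p.+1 + n')%N else b j).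
    - move=> [|n]; first by apply: increasing_chain_ltn; rewrite // addn0 ltnS.
      by rewrite addnS; exact: ib.
    - by case=> [|n]; exact: bM.
    exists m => _; move: Fm; rewrite /= -[1%N]/(1 + 0)%N iotaDl -map_comp.
    exact.
  pose m j := sval (mP j).
  have mnr (j : 'I_p.+1) :
      ~ removable K d e (b j) [seq b (p.+1 + i) | i <- iota 0 (m j)]%N.
    by have := svalP (mP j); apply; rewrite -ltnS.
  pose j0 := [arg max_(j > ord0 : 'I_p.+1) m j].
  have mj0 (j : 'I_p.+1) : (m j <= m j0)%N.
    by rewrite /j0; case: arg_maxnP => // i _; apply.
  (* The longest segment contains the others, so this single [f] meets the hypothesis for every [j];
     were it small at [b j], it would itself witness removability there. *)
  have := mnr j0; rewrite /removable => /not_implyP[[f Kf fd] _].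
  exists f; split=> // j; rewrite -ltnS => jp.
  rewrite leNgt; apply/negP => fje; apply: (mnr (Ordinal jp)) => _.
  exists f => //; split=> [v /mapP[i + ->]|]; last exact: ltW.
  rewrite mem_iota add0n /= => im; apply: fd; apply: map_f.
  by rewrite mem_iota add0n (leq_trans im (mj0 (Ordinal jp))).
have [h hP'] := choice hP.
have [f fB fe] := dual_ball_cluster (fun n => KB _ (hP' n).1).
have [n] := x_null ib fB e0.
apply/negP; rewrite -leNgt; apply: (fe _ _ n) => k nk.
exact: (hP' k).2.
Qed.

Variable coord : dyadic -> X -> R.
Hypothesis coord_ball : forall u, dual_ball (coord u).

(** Discretizing the levels leaves finitely many constraints at each node [u], those with [k] at
    most the length of [u]. *)
Definition threshold (k : nat) : R := k.+1%:R^-1.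

Definition tolerance (k : nat) : R := threshold k ^+ 2 / 64.

Lemma threshold_gt0 k : 0 < threshold k.
Proof. by rewrite invr_gt0 ltr0n. Qed.

Lemma tolerance_gt0 k : 0 < tolerance k.
Proof. by rewrite divr_gt0 // exprn_gt0 // threshold_gt0. Qed.

Definition prescribed (k : nat) (u : dyadic) (A B : {set 'I_(size u).+1}) : set (X -> R) :=
  [set f | [/\ dual_ball f, forall i, i \in A -> threshold k <= f (x (take i u)) &
    forall i, i \in B -> `|f (x (take i u))| <= tolerance k]].

Lemma prescribed_ball k u A B f : @prescribed k u A B f -> dual_ball f.
Proof. by case. Qed.

(* Since the n-th element of a chain has length at least n, the second condition
   makes the matrix [coord (s j) (x (s n))] along a chain [s] a perturbation, with
   entries at most 16^-n for j < n, of a lower unitriangular matrix. *)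
Definition good_above (u : dyadic) (M : set dyadic) :=
  (forall (k : 'I_(size u).+1) (A B : {set 'I_(size u).+1}),
     removable_on (prescribed k A B) (threshold k) (tolerance k) M) /\
  (forall (i : 'I_(size u).+1) t, M t ->
     `|coord (take i u) (x t)| <= 16%:R ^- (size u).+1).

Lemma removable_onS K d e M M' : M' `<=` M -> removable_on K d e M -> removable_on K d e M'.
Proof. by move=> M'M rM t s ts tsM; apply: rM ts _ => u /tsM/M'M. Qed.

(** Each node imposes finitely many constraints, each hereditary and satisfiable on a perfect
    subset, so fusion applies. *)
Lemma good_tree : exists2 t, tree_embedding t &
  forall u, range t u -> good_above u (above (range t) u).
Proof.
have p0 : perfect setT.
  split; first by exists [::].
  move=> u _; exists (rcons u true), (rcons u false).
  have sp b : spre u (rcons u b).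
    rewrite /spre prefix_rcons; apply/eqP => /(congr1 size).
    by rewrite size_rcons => /n_Sn.
  by split=> //; rewrite /incomparable -!cats1 !prefix_catr //= !andbF.
have [||//|t tP [_ tD]] := @fusion good_above setT; last by exists t.
  move=> u M M' M'M [rM cM]; split; last by move=> i v /M'M; exact: cM.
  by move=> k A B; exact: removable_onS (rM k A B).
move=> u M pM.
have [M1 [pM1 M1M] DM1] := @dense_finite
    ('I_(size u).+1 * {set 'I_(size u).+1} * {set 'I_(size u).+1})%type
    (enum {: 'I_(size u).+1 * {set 'I_(size u).+1} * {set 'I_(size u).+1}})
    (fun p => removable_on (prescribed p.1.1 p.1.2 p.2) (threshold p.1.1) (tolerance p.1.1))
    (fun p => @removable_onS _ _ _)
    (fun p M pM => removable_dense _ (@prescribed_ball _ _ _ _) (tolerance_gt0 _) pM)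
    M pM.
have e0 : 0 < 16%:R ^- (size u).+1 :> R by rewrite invr_gt0 exprn_gt0 // ltr0n.
have [M2 [pM2 M21] DM2] := @dense_finite 'I_(size u).+1 (enum 'I_(size u).+1)
    (fun i M => forall t, M t -> `|coord (take i u) (x t)| <= 16%:R ^- (size u).+1)
    (fun i M M' M'M H t M't => H t (M'M t M't))
    (fun i M pM => dual_ball_small pM (coord_ball _) e0) M1 pM1.
exists M2; first by split=> //; exact: subset_trans M1M.
split=> [k A B|i]; last by apply: DM2; rewrite mem_enum.
apply: removable_onS M21 _.
by apply: (DM1 (k, A, B)); rewrite mem_enum.
Qed.

Section Chain.
Variables (T : set dyadic) (s : nat -> dyadic).
Hypothesis T_good : forall u, T u -> good_above u (above T u).
Hypothesis s_inc : increasing_chain s.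
Hypothesis sT : forall n, T (s n).

Lemma chain_coord j n : (j < n)%N -> `|coord (s j) (x (s n))| <= 16%:R ^- n.
Proof.
case: n => // n; rewrite ltnS => jn.
(* After the shift of [n], the predecessor [s n], of length at least [n], controls the value at
   [s n.+1]. *)
have [_ H] := T_good (sT n).
have pj : prefix (s j) (s n).
  move: jn; rewrite leq_eqVlt => /predU1P[->|]; first exact: prefix_refl.
  by move/(increasing_chain_ltn s_inc)/spre_prefix.
have jlt : (size (s j) < (size (s n)).+1)%N by rewrite ltnS prefix_sub_size.
have := H (Ordinal jlt) (s n.+1) (conj (sT _) (s_inc n)).
rewrite /= prefix_takeE // => /le_trans; apply.
rewrite lef_pV2 ?posrE ?exprn_gt0 ?ltr0n // ler_weXn2l ?ler1n //.
by rewrite ltnS; exact: increasing_chain_size.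
Qed.

(** Indices outside [P] are treated in increasing order, each time replacing the functional.
    Removability keeps the lower bounds at later points, while [prescribed] keeps the lower bounds
    and the smallness at earlier ones. Starting after [k] ensures that the predecessor of the
    removed point is long enough to handle level [k]. *)
Lemma chain_split k m (P : pred nat) (f : X -> R) : dual_ball f ->
  (forall n, (k < n < m)%N -> P n -> threshold k <= f (x (s n))) ->
  exists2 g, dual_ball g & forall n, (k < n < m)%N ->
    if P n then threshold k <= g (x (s n)) else `|g (x (s n))| <= tolerance k.
Proof.
move=> fB fP.
suff [g gB [gP gN]] : exists2 g, dual_ball g &
    (forall n, (k < n < m)%N -> P n -> threshold k <= g (x (s n))) /\
    (forall n, (k < n < m)%N -> ~~ P n -> `|g (x (s n))| <= tolerance k).
  by exists g => // n nkm; case: ifPn; [exact: gP|exact: gN].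
suff H j : (j <= m)%N -> exists2 g, dual_ball g &
    (forall n, (k < n < m)%N -> P n -> threshold k <= g (x (s n))) /\
    (forall n, (k < n < j)%N -> ~~ P n -> `|g (x (s n))| <= tolerance k).
  exact: H.
elim: j => [_|j IH jm]; first by exists f => //; split=> // n; rewrite ltn0 andbF.
have [g gB [gP gN]] := IH (ltnW jm).
have [skip|] := boolP ((j <= k)%N || P j).
  exists g => //; split=> // n /andP[kn]; rewrite ltnS leq_eqVlt => /predU1P[nj|nj] nP.
    by move: skip; rewrite -nj (negPf nP) orbF leqNgt kn.
  by apply: gN; rewrite ?kn.
rewrite negb_or -ltnNge => /andP[kj nPj].
case: j => // i in IH jm gN kj nPj *.
set u := s i.
have ku : (k < (size u).+1)%N.
  by rewrite ltnS (leq_trans _ (increasing_chain_size s_inc i)).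
have below n : (n < i.+1)%N -> prefix (s n) u.
  rewrite ltnS leq_eqVlt => /predU1P[->|]; first exact: prefix_refl.
  by move/(increasing_chain_ltn s_inc)/spre_prefix.
(* The indices in [Q] from [k.+1] to [i], encoded by the lengths of their nodes, which are prefixes
   of [u]. *)
pose C (Q : pred nat) : {set 'I_(size u).+1} :=
  [set a : 'I_(size u).+1 | [exists n : 'I_i.+1, [&& (k < n)%N, Q n & take a u == s n]]]%SET.
have CP (Q : pred nat) (H : X -> Prop) :
    (forall a, a \in C Q -> H (x (take a u))) <->
    (forall n, (k < n < i.+1)%N -> Q n -> H (x (s n))).
  split=> [CH n /andP[kn ni] Qn|QH a].
    have sz : (size (s n) < (size u).+1)%N by rewrite ltnS prefix_sub_size ?below.
    have /= := CH (Ordinal sz); rewrite prefix_takeE ?below //; apply.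
    rewrite inE; apply/existsP; exists (Ordinal ni).
    by rewrite /= kn Qn prefix_takeE ?below /=.
  rewrite inE => /existsP[n /and3P[kn Qn /eqP ->]].
  by apply: QH => //; rewrite kn /=.
have [rem _] := T_good (sT i).
pose r := [seq n <- iota i.+2 (m - i.+2) | P n].
have ss : sorted spre (s i.+1 :: map s r).
  apply: (@homo_sorted _ _ s ltn spre (increasing_chain_ltn s_inc) (i.+1 :: r)).
  have := iota_ltn_sorted i.+1 (m - i.+2).+1.
  apply: subseq_sorted; first exact: ltn_trans.
  by rewrite /= eqxx filter_subseq.
have inr n : n \in r = (i.+1 < n < m)%N && P n.
  by rewrite mem_filter mem_iota andbC subnKC.
have [||g' [g'B g'C g'D] [g'r g'i]] := rem (Ordinal ku) (C P) (C (predC P)) _ _ ss.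
- move=> v; rewrite -(@map_cons _ _ s) => /mapP[n nr ->]; split=> //.
  apply: increasing_chain_ltn => //.
  by move: nr; rewrite inE => /predU1P[->|]; rewrite // inr => /andP[/andP[/ltnW]].
- exists g; last first.
    move=> v /mapP[n + ->]; rewrite inr => /andP[/andP[ni nm]] Pn.
    by apply: gP => //; rewrite nm (ltn_trans kj ni).
  split=> //.
    by apply/(CP P (fun y => _ <= g y)) => n /andP[kn ni]; apply: gP; rewrite kn (ltn_trans ni).
  exact/(CP (predC P) (fun y => `|g y| <= _)).
exists g' => //; split=> n /andP[kn nm] Pn.
  have [ni|] := ltnP n i.+1.
    by move/(CP P (fun y => _ <= g' y)): g'C; apply => //; rewrite kn.
  rewrite leq_eqVlt => /predU1P[ni|ni]; first by rewrite ni Pn in nPj.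
  by apply/g'r/map_f; rewrite inr ni nm Pn.
move: nm; rewrite ltnS leq_eqVlt => /predU1P[->//|ni].
by move/(CP (predC P) (fun y => `|g' y| <= _)): g'D; apply => //; rewrite kn.
Qed.


Hypothesis x_norm1 : forall u, `|x u| = 1.
Hypothesis coord_norming : forall u, coord u (x u) = 1.

(** * Lower bounds along a chain *)

Lemma geometric_sum_le j : \sum_(0 <= n < j) (4%:R : R) ^+ n <= 4%:R ^+ j / 3%:R.
Proof.
elim: j => [|j IH]; first by rewrite big_geq // divr_ge0.
rewrite big_nat_recr //= exprS; lra.
Qed.

Lemma geometric_tail_le j m : \sum_(j.+1 <= n < m) (4%:R : R) ^- n <= 3%:R^-1.
Proof.
have [mj|jm] := leqP m j.+1; first by rewrite big_geq // invr_ge0.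
suff : \sum_(j.+1 <= n < m) (4%:R : R) ^- n + 4%:R ^- m * (4%:R / 3%:R) <= 4%:R ^- j / 3%:R.
  have : 4%:R ^- j <= 1 :> R by rewrite invf_le1 ?exprn_gt0 // exprn_ege1 // ler1n.
  have : 0 <= 4%:R ^- m :> R by rewrite invr_ge0 exprn_ge0.
  lra.
elim: m jm => // m IH; rewrite ltnS leq_eqVlt => /predU1P[<-|jm].
  by rewrite big_nat1 !exprS !invfM; lra.
rewrite big_nat_recr //=; last exact: ltnW.
move: (IH jm); rewrite exprS invfM; lra.
Qed.

(* Evaluate [coord (s j)] at the sum for the [j] that maximizes |b j| / 4^j. *)
Lemma chain_coefficient_le m (b : nat -> R) j : (j < m)%N ->
  `|b j| <= 3%:R * 4%:R ^+ j * `|\sum_(0 <= n < m) b n *: x (s n)|.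
Proof.
move=> jm; set N := `|\sum_(0 <= n < m) _|.
have p4 i : 0 < 4%:R ^+ i :> R by rewrite exprn_gt0.
have [j0 j0max] : exists j0 : 'I_m, forall i : 'I_m,
    `|b i| / 4%:R ^+ i <= `|b j0| / 4%:R ^+ j0.
  case: (@arg_maxP _ _ _ (Ordinal jm) xpredT (fun i : 'I_m => `|b i| / 4%:R ^+ i)) => // i _ imax.
  by exists i => i'; exact: imax.
set A := `|b j0| / 4%:R ^+ j0.
have A0 : 0 <= A by rewrite divr_ge0 // ltW.
have bA i : (i < m)%N -> `|b i| <= A * 4%:R ^+ i.
  by move=> im; rewrite -ler_pdivrMr //; exact: (j0max (Ordinal im)).
suff A3 : A <= 3%:R * N.
  by apply: le_trans (bA j jm) _; rewrite [leRHS]mulrAC ler_wpM2r // ltW.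
have eqA : `|b j0| = A * 4%:R ^+ j0 by rewrite divfK // gt_eqF.
pose c n := b n * coord (s j0) (x (s n)).
have cN : `|\sum_(0 <= n < m) c n| <= N.
  rewrite -(dual_ball_sum _ _ _ _ (coord_ball (s j0))).
  exact: (coord_ball _).2.
have j0m := ltn_ord j0.
have csplit : \sum_(0 <= n < m) c n =
    \sum_(0 <= n < j0) c n + b j0 + \sum_(j0.+1 <= n < m) c n.
  rewrite (@big_cat_nat _ _ _ j0.+1) //= big_nat_recr //=.
  by rewrite {2}/c coord_norming mulr1.
have low : `|\sum_(0 <= n < j0) c n| <= A * (4%:R ^+ j0 / 3%:R).
  apply: le_trans (ler_norm_sum _ _ _) _.
  apply: le_trans (_ : \sum_(0 <= n < j0) A * 4%:R ^+ n <= _); last first.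
    by rewrite -mulr_sumr ler_wpM2l // geometric_sum_le.
  apply: ler_sum_nat => n /andP[_ nj].
  rewrite normrM -[leRHS]mulr1 ler_pM // ?bA ?(ltn_trans nj) //.
  by rewrite -(x_norm1 (s n)); exact: (coord_ball _).2.
have high : `|\sum_(j0.+1 <= n < m) c n| <= A * 3%:R^-1.
  apply: le_trans (ler_norm_sum _ _ _) _.
  apply: le_trans (_ : \sum_(j0.+1 <= n < m) A * 4%:R ^- n <= _); last first.
    by rewrite -mulr_sumr ler_wpM2l // geometric_tail_le.
  apply: ler_sum_nat => n /andP[jn nm].
  have -> : 4%:R ^- n = 4%:R ^+ n * 16%:R ^- n :> R.
    have -> : (16%:R : R) = 4%:R * 4%:R by lra.
    by rewrite exprMn invfM mulrA divff ?mul1r // gt_eqF.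
  by rewrite normrM mulrA ler_pM // ?bA // chain_coord.
(* The two off-diagonal sums take up at most two thirds of [A * 4%:R ^+ j0], which leaves one third
   to be bounded by [N]. *)
have : `|b j0| <= `|\sum_(0 <= n < m) c n| + `|\sum_(0 <= n < j0) c n|
    + `|\sum_(j0.+1 <= n < m) c n|.
  have -> : b j0 = \sum_(0 <= n < m) c n - \sum_(0 <= n < j0) c n
      - \sum_(j0.+1 <= n < m) c n by rewrite csplit; ring.
  by apply: le_trans (ler_normB _ _) _; rewrite lerD2r ler_normB.
have e1 : 1 <= 4%:R ^+ j0 :> R by rewrite exprn_ege1 // ler1n.
have AE : A <= A * 4%:R ^+ j0 by rewrite ler_peMr.
rewrite eqA; move: low high cN; rewrite mulrA; lra.
Qed.

Lemma threshold_le1 k : threshold k <= 1.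
Proof. by rewrite invf_le1 ?ltr0n // ler1n. Qed.

(* The signs are absorbed by keeping only the coordinates on which [b n] and
   [h (x (s n))] have a constant sign: there the functional given by
   [chain_split] bounds the norm from below. *)
Lemma chain_part_le k m (a b : nat -> R) (h : X -> R) (tau : R) :
  (forall n, `|b n| = `|a n|) -> \sum_(0 <= n < m) `|a n| <= 1 ->
  \sum_(0 <= n < m) (if (n <= k)%N then `|a n| else 0) <= tolerance k ->
  dual_ball h -> `|tau| = 1 ->
  threshold k * \sum_(0 <= n < m)
     (if [&& (k < n)%N, threshold k <= h (x (s n)) & 0 <= tau * b n] then `|a n| else 0)
  <= `|\sum_(0 <= n < m) b n *: x (s n)| + 2%:R * tolerance k.
Proof.
move=> ba a1 alow hB tau1.
pose P n := (threshold k <= h (x (s n))) && (0 <= tau * b n).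
have [|g gB gP] := @chain_split k m P h hB; first by move=> n _ /andP[].
have gN : tau * g (\sum_(0 <= n < m) b n *: x (s n)) <= `|\sum_(0 <= n < m) b n *: x (s n)|.
  apply: le_trans (ler_norm _) _; rewrite normrM tau1 mul1r; exact: gB.2.
(* Term by term: an index in [P] beyond [k] gains at least [threshold k] times its weight, another
   index beyond [k] loses at most [tolerance k] times it, and an index up to [k] loses at most the
   full weight. *)
suff : threshold k * \sum_(0 <= n < m) (if (k < n)%N && P n then `|a n| else 0)
    - tolerance k * \sum_(0 <= n < m) `|a n|
    - \sum_(0 <= n < m) (if (n <= k)%N then `|a n| else 0)
    <= tau * g (\sum_(0 <= n < m) b n *: x (s n)).
  have := ler_wpM2l (ltW (tolerance_gt0 k)) a1; rewrite mulr1 /P; lra.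
rewrite dual_ball_sum // !mulr_sumr -!sumrB; apply: ler_sum_nat => n /andP[_ nm].
have tb : `|tau * b n| = `|a n| by rewrite normrM tau1 mul1r ba.
have tol0 := tolerance_gt0 k; have a0 := normr_ge0 (a n).
have low : - (`|a n| * `|g (x (s n))|) <= tau * (b n * g (x (s n))).
  by rewrite mulrA -tb -normrM lerNl -normrN ler_norm.
case: ltnP => /= kn.
  have := gP n; rewrite kn nm => /(_ isT); case: ifPn => [/andP[_ bp] gd|_ ge].
    rewrite mulrA -(ger0_norm bp) tb subr0 mulrC.
    have := ler_wpM2l a0 gd; have := mulr_ge0 (ltW tol0) a0; lra.
  apply: le_trans low; rewrite mulr0 sub0r subr0 lerN2 mulrC.
  exact: ler_wpM2r.
apply: le_trans low; rewrite mulr0 sub0r.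
have : `|a n| * `|g (x (s n))| <= `|a n| * 1.
  by rewrite ler_wpM2l // -(x_norm1 (s n)); exact: gB.2.
have := mulr_ge0 (ltW tol0) a0; lra.
Qed.

(** The coefficient estimate, with factor 3 times [4 ^ k], applied to a coefficient of size at least
    [threshold k ^+ 3 / 64]. *)
Definition lower_constant (k : nat) : R := threshold k ^+ 3 / (192%:R * 4%:R ^+ k).

Lemma lower_constant_gt0 k : 0 < lower_constant k.
Proof.
by rewrite divr_gt0 ?exprn_gt0 ?threshold_gt0 // mulr_gt0 // exprn_gt0.
Qed.

(** If the coefficients up to [k] have large total weight, one of them is large and the coefficient
    estimate suffices. Otherwise a functional norming the [a]-sum is split by its sign and that of
    [b n] into four parts, each bounded by the [b]-sum. *)
Lemma chain_unconditional k m (a b : nat -> R) :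
  (forall n, `|b n| = `|a n|) -> \sum_(0 <= n < m) `|a n| <= 1 ->
  2%:R * threshold k <= `|\sum_(0 <= n < m) a n *: x (s n)| ->
  lower_constant k <= `|\sum_(0 <= n < m) b n *: x (s n)|.
Proof.
move=> ba a1 ad; set N := `|\sum_(0 <= n < m) b n *: x (s n)|.
have d0 := threshold_gt0 k; have d1 := threshold_le1 k.
have p4 : 1 <= 4%:R ^+ k :> R by rewrite exprn_ege1 // ler1n.
have [alow|ahigh] := leP (\sum_(0 <= n < m) (if (n <= k)%N then `|a n| else 0))
    (tolerance k); last first.
  have [j jm [jk aj]] : exists2 j, (j < m)%N & (j <= k)%N /\ threshold k ^+ 3 / 64 <= `|a j|.
    apply: contrapT => nex; move: ahigh; apply/negP; rewrite -leNgt.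
    (* Pigeonhole over the at most [k.+1] initial indices, using that [k.+1] times [threshold k] is
       1. *)
    have -> : tolerance k = threshold k ^+ 3 / 64 * k.+1%:R.
      rewrite /tolerance /threshold exprS.
      have : k.+1%:R != 0 :> R by rewrite pnatr_eq0.
      by move=> ?; field.
    have c0 : 0 <= threshold k ^+ 3 / 64 by rewrite divr_ge0 // exprn_ge0 // ltW.
    set c := threshold k ^+ 3 / 64 in nex c0 *.
    apply: le_trans (_ : \sum_(0 <= n < m | (n <= k)%N) c <= _).
      rewrite [leRHS]big_mkcond; apply: ler_sum_nat => n /andP[_ nm].
      case: ifPn => // nk; apply/ltW; rewrite ltNge; apply/negP => an.
      by apply: nex; exists n.
    rewrite big_const_seq iter_addr_0 -[leLHS]mulr_natr ler_wpM2l // ler_nat.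
    rewrite -(size_iota 0 k.+1) -size_filter uniq_leq_size ?filter_uniq ?iota_uniq //.
    by move=> n; rewrite mem_filter mem_iota ltnS => /andP[].
  have := chain_coefficient_le b jm; rewrite -/N ba => Nj.
  rewrite ler_pdivrMr ?mulr_gt0 ?exprn_gt0 //.
  have : 3%:R * 4%:R ^+ j * N <= 3%:R * 4%:R ^+ k * N.
    apply: ler_wpM2r; first exact: normr_ge0.
    by apply: ler_wpM2l => //; rewrite ler_weXn2l // ler1n.
  lra.
have [f fB fN] := hahn_banach_norming (\sum_(0 <= n < m) a n *: x (s n)).
have nfB := dual_ballN fB.
have n1 : `|1 : R| = 1 by rewrite normr1.
have nN1 : `|- 1 : R| = 1 by rewrite normrN1.
have := chain_part_le ba a1 alow fB n1; have := chain_part_le ba a1 alow fB nN1.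
have := chain_part_le ba a1 alow nfB n1; have := chain_part_le ba a1 alow nfB nN1.
rewrite -/N.
set S1 := \sum_(0 <= n < m) _; set S2 := \sum_(0 <= n < m) _.
set S3 := \sum_(0 <= n < m) _; set S4 := \sum_(0 <= n < m) _ => h1 h2 h3 h4.
(* Terms where the functional is at most [threshold k] in modulus go to the first sum, initial terms
   to the second, and every other term to at least one of the four parts. *)
have tot : 2%:R * threshold k <= threshold k * \sum_(0 <= n < m) `|a n|
    + \sum_(0 <= n < m) (if (n <= k)%N then `|a n| else 0) + S1 + S2 + S3 + S4.
  rewrite (le_trans ad) // -fN dual_ball_sum // mulr_sumr -!big_split /=.
  apply: ler_sum => n _; have a0 := normr_ge0 (a n).
  have fx1 : `|f (x (s n))| <= 1 by rewrite -(x_norm1 (s n)); exact: fB.2.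
  have afa : a n * f (x (s n)) <= `|a n| * `|f (x (s n))|.
    by rewrite -normrM ler_norm.
  have afa1 : a n * f (x (s n)) <= `|a n|.
    by apply: le_trans afa _; rewrite -[leRHS]mulr1 ler_wpM2l.
  have da0 : 0 <= threshold k * `|a n| by rewrite mulr_ge0 // ltW.
  have ifge (c : bool) : 0 <= (if c then `|a n| else 0) by case: c.
  have [kn|nk] := ltnP k n; last by rewrite /= !addr0; lra.
  rewrite /= addr0.
  have [fd|fd] := leP `|f (x (s n))| (threshold k).
    apply: le_trans afa _; apply: le_trans (_ : threshold k * `|a n| <= _).
      by rewrite mulrC ler_wpM2r.
    by rewrite -!addrA lerDl !addr_ge0.
  have big (c1 c2 c3 c4 : bool) : [|| c1, c2, c3 | c4] ->
      `|a n| <= (if c1 then `|a n| else 0) + (if c2 then `|a n| else 0)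
        + (if c3 then `|a n| else 0) + (if c4 then `|a n| else 0).
    by case: c1; case: c2; case: c3; case: c4 => // _; lra.
  have cond : [|| (threshold k <= - f (x (s n))) && (0 <= -1 * b n),
     (threshold k <= - f (x (s n))) && (0 <= 1 * b n),
     (threshold k <= f (x (s n))) && (0 <= -1 * b n)
   | (threshold k <= f (x (s n))) && (0 <= 1 * b n)].
    rewrite mulN1r mul1r oppr_ge0.
    have [->|] := eqVneq (b n) 0; first by rewrite lexx !andbT;
      case: (ger0P (f (x (s n)))) fd => _ /ltW ->; rewrite ?orbT.
    have [b0|b0] := leP (b n) 0; case: (ger0P (f (x (s n)))) fd => _ /ltW ->;
      by rewrite /= ?orbT ?(ltW b0) ?orbT.
  apply: le_trans afa1 _; apply: le_trans (big _ _ _ _ cond) _.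
  by rewrite -!addrA lerDr.
have tot' : threshold k * (2%:R * threshold k) <=
    threshold k * (threshold k + tolerance k + S1 + S2 + S3 + S4).
  rewrite ler_wpM2l ?(ltW d0) //.
  have := ler_wpM2l (ltW d0) a1; rewrite mulr1; move: tot alow; lra.
have dd : 0 <= threshold k ^+ 2 by rewrite exprn_ge0 // ltW.
have ddd : threshold k ^+ 3 <= threshold k ^+ 2.
  by rewrite exprS ler_piMl.
(* The four estimates give [4 N] at least [threshold k ^+ 2] minus nine tolerances; the factor 64 in
   [tolerance] leaves more than half of the square. *)
apply: le_trans (_ : threshold k ^+ 2 / 8%:R <= _).
  have q0 : 0 < 192%:R * 4%:R ^+ k :> R by lra.
  rewrite /lower_constant ler_pM ?invr_ge0 ?(ltW q0) ?exprn_ge0 ?(ltW d0) //.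
  by rewrite lef_pV2 ?posrE //; lra.
move: h1 h2 h3 h4 tot' dd ddd; rewrite /tolerance !exprS expr0; lra.
Qed.

End Chain.
End Removal.

(** * Chains as sets, infinite combinations and the theorem *)

Lemma increasing_chain_range b : increasing_chain b ->
  chain setT (range b) /\ chain_enum (range b) b.
Proof.
move=> ib; split; last by split=> // n; apply/sprefixE; exact: ib.
split=> //.
  move=> fin; apply: infinite_nat; move: fin; apply/card_le_finite.
  have /card_eqPle[] := @inj_card_eq _ _ setT b (in2W (increasing_chain_inj ib)).
  by [].
move=> _ _ [m _ <-] [n _ <-]; case: (ltngtP m n) => [mn|nm|->].
- by left; apply: spre_prefix; exact: increasing_chain_ltn.
- by right; apply: spre_prefix; exact: increasing_chain_ltn.
- by left; exact: prefix_refl.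
Qed.

(** Both series converge absolutely. Long partial sums of the first have norm at least [delta / 2],
    and the lower bound [C] for those of the second is a closed condition. *)
Lemma unconditional_bound_partial (R : realType) (X : completeNormedModType R)
    (y : nat -> X) (delta C : R) : 0 < delta -> (forall n, `|y n| = 1) ->
  (forall m (a b : nat -> R), (forall n, `|b n| = `|a n|) ->
     \sum_(0 <= n < m) `|a n| <= 1 ->
     delta / 2 <= `|\sum_(0 <= n < m) a n *: y n| ->
     C <= `|\sum_(0 <= n < m) b n *: y n|) ->
  unconditional_bound y delta C.
Proof.
move=> delta0 y1 H a a1 aD eps epsP.
have epsa n : `|eps n * a n| = `|a n|.
  by case: (epsP n) => ->; rewrite ?mul1r // mulN1r normrN.
have cvg_comb c : (forall n, `|c n| = `|a n|) ->
    series (fun n => c n *: y n) @ \oo --> combination c y.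
  move=> ca; apply: normed_cvg; rewrite /normed_series_of /=.
  have -> : (fun n => `|c n *: y n|) = (fun n => `|a n|).
    by apply/funext => n; rewrite normrZ ca y1 mulr1.
  by apply/cvg_ex; exists 1.
have part_le m : \sum_(0 <= n < m) `|a n| <= 1.
  rewrite -(cvg_lim _ a1) //; apply: (@nondecreasing_cvgn_le _ (series (fun n => `|a n|))).
    by apply: nondecreasing_series.
  by apply/cvg_ex; exists 1.
apply: (@closed_cvg _ _ \oo _ (fun m => `|series (fun n => (eps n * a n) *: y n) m|)
  (fun r => C <= r)).
- exact: closed_ge.
- have big : delta / 2 < `|combination a y| by lra.
  have [N _ HN] := cvgr_norm_ge _ (cvg_comb a (fun=> erefl)) _ big.
  by exists N => // m Nm; exact: H epsa (part_le m) (HN m Nm).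
- by apply: cvg_norm; exact: cvg_comb.
Qed.

Theorem theorem5p1 (R : realType) (X : completeNormedModType R)
    (x : dyadic -> X)
    (x_normalized : forall s : dyadic, `|x s| = 1)
    (x_weakly_null : forall (beta : set dyadic) (s : nat -> dyadic),
       chain setT beta -> chain_enum beta s ->
       weakly_null (fun n => x (s n))) :
  exists T : set dyadic,
    [/\ subtree T,
        (forall delta : R, 0 < delta ->
           exists C : R, 0 < C /\
             forall (beta : set dyadic) (s : nat -> dyadic),
               chain T beta -> chain_enum beta s ->
               unconditional_bound (fun n => x (s n)) delta C)
      & (forall (beta : set dyadic) (s : nat -> dyadic),
           chain T beta -> chain_enum beta s ->
           convexly_unconditional (fun n => x (s n)))].
Proof.
have x_null b : increasing_chain b -> forall f : X -> R, dual_ball f ->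
    forall e : R, 0 < e -> exists n, `|f (x (b n))| < e.
  move=> ib f fB e e0; have [cb eb] := increasing_chain_range ib.
  have fx := weakly_null_dual_ball (x_weakly_null _ _ cb eb) fB.
  have [N _ Ne] := cvgr0_norm_lt _ fx _ e0.
  by exists N; apply: Ne => /=.
have /choice[coord coordP] u : exists f : X -> R, dual_ball f /\ f (x u) = `|x u|.
  by have [f fB fx] := hahn_banach_norming (x u); exists f.
have [t tP tgood] := good_tree x_null (fun u => (coordP u).1).
have main (delta : R) : 0 < delta -> exists C : R, 0 < C /\
    forall (beta : set dyadic) (s : nat -> dyadic),
      chain (range t) beta -> chain_enum beta s ->
      unconditional_bound (fun n => x (s n)) delta C.
  (* Partial sums only reach [delta / 2], and the finite estimate needs twice the threshold; hence
     the quarter. *)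
  move=> delta0; have [k] : exists k, 0 + k.+1%:R^-1 < delta / 4.
    by apply: ltr_add_invr; rewrite divr_gt0.
  rewrite add0r => kd; exists (lower_constant R k); split; first exact: lower_constant_gt0.
  move=> beta s [bT _ _] [s_inc s_range]; apply: unconditional_bound_partial => //.
  move=> m a b ba a1 aD.
  apply: (chain_unconditional (fun u => (coordP u).1) tgood _ _ _ _ ba a1) => //.
  - by move=> n; apply/sprefixE.
  - by move=> n; apply: bT; rewrite -s_range; exists n.
  - by move=> u; rewrite (coordP u).2.
  - have tk : threshold R k < delta / 4 := kd.
    apply: le_trans aD; lra.
exists (range t); split=> //; first exact: subtree_range_embedding.
move=> beta s bT be; split=> [n|delta delta0]; first exact: x_normalized.
by have [C [C0 CP]] := main delta delta0; exists C; split=> //; exact: CP bT be.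
Qed.
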